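(* Let $A\in\mathbb{R}^{n\times n}$, $E\in\mathbb{R}^{n\times m}$, $\mathcal{X}\subset\mathbb{R}^n$, $\mathcal{D}^\ast\subset\mathbb{R}^m$ satisfy the structural and strict stability assumptions listed in the context, let $\epsilon\in\mathbb{R}_+$, and let $$\alpha^\ast:=\sup\{\alpha\in\mathbb{R}_+\mid\alpha\,\mathcal{R}_\infty^1\subseteq\mathcal{X}\}.$$ Consider the following algorithm. (i) Choose the smallest $M\in\mathbb{N}_{[1,r]}$ such that $\Gamma=\begin{pmatrix}A_{11}^0E_1&\dots&A_{11}^{M-1}E_1\end{pmatrix}\in\mathbb{R}^{r\times(Mm)}$ has full rank, and define $\mathcal{W}:=\bigoplus_{k=0}^{M-1}A_{11}^kE_1\,\mathcal{D}^\ast$. (ii) Set $\eta=\epsilon\,(1+\epsilon)^{-1}$ and choose the smallest $N\in\mathbb{N}_+$ such that $A_{11}^{MN}\,\mathcal{W}\subseteq\eta\,\mathcal{W}$. (iii) Set $k=MN$, compute $\overline{\alpha}:=\max\{\alpha\in\mathbb{R}_+\mid\alpha\,\mathcal{R}_k^1\subseteq\mathcal{X}\}$, and return $\underline{\alpha}:=\overline{\alpha}\,(1+\epsilon)^{-1}$ and $\overline{\alpha}$. Then the algorithm computes $\underline{\alpha}$ and $\overline{\alpha}$ such that $$\underline{\alpha}\leq\alpha^\ast\leq\overline{\alpha}\qquad\text{and}\qquad\frac{\overline{\alpha}}{\underline{\alpha}}-1=\epsilon.$$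
   Context: Notation: $\mathbb{R}_+$ and $\mathbb{N}_+$ are the positive reals and positive integers, $\mathbb{N}=\{0,1,2,\dots\}$, $\mathbb{N}_{[i,k]}=\{j\in\mathbb{N}\mid i\le j\le k\}$. A C-set is a convex and compact set containing the origin as an interior point. For sets, $\beta\,\mathcal{U}=\{\beta u\mid u\in\mathcal{U}\}$, $D\,\mathcal{U}=\{Du\mid u\in\mathcal{U}\}$, $\mathcal{U}\oplus\mathcal{V}$ is the Minkowski sum (and $\bigoplus$ denotes iterated Minkowski sums). Assumptions: there is $r\in\mathbb{N}_{[1,n]}$ such that $$A=\begin{pmatrix}A_{11}&A_{12}\\0&A_{22}\end{pmatrix},\qquad E=\begin{pmatrix}E_1\\0\end{pmatrix}$$ with $A_{11}\in\mathbb{R}^{r\times r}$, $A_{12}\in\mathbb{R}^{r\times(n-r)}$, $A_{22}\in\mathbb{R}^{(n-r)\times(n-r)}$, $E_1\in\mathbb{R}^{r\times m}$; the pair $(A_{11},E_1)$ is controllable; $\mathcal{X}\subset\mathbb{R}^n$ and $\mathcal{D}^\ast\subset\mathbb{R}^m$ are C-sets; all eigenvalues $\lambda\in\mathbb{C}$ of $A_{11}$ and $A_{22}$ satisfy $|\lambda|<1$. The sets $\mathcal{R}_k^1$ are defined by $\mathcal{R}_0^1:=\{0\}$ and $\mathcal{R}_{k+1}^1:=A\,\mathcal{R}_k^1\oplus E\,\mathcal{D}^\ast$ for $k\in\mathbb{N}$, and $\mathcal{R}_\infty^1:=\bigcup_{k=0}^\infty\mathcal{R}_k^1$. *)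

(* Defs.v *)
From HB Require Import structures.
From mathcomp Require Import all_boot all_order all_algebra.
From mathcomp Require Import all_classical all_reals all_analysis.
From mathcomp Require Import complex.

Set Implicit Arguments.
Unset Strict Implicit.
Unset Printing Implicit Defensive.

Import Order.TTheory GRing.Theory Num.Theory.
Import numFieldNormedType.Exports.

Local Open Scope classical_set_scope.
Local Open Scope ring_scope.

Definition is_min_nat (S : set nat) (i : nat) : Prop :=
  S i /\ forall j, S j -> (i <= j)%N.

Definition is_max (R : realType) (S : set R) (a : R) : Prop :=
  S a /\ ubound S a.

Definition Cset (R : realType) (n : nat) (U : set 'cV[R]_n) : Prop :=
  [/\ convex_set U, compact U & interior U 0].

Definition scale_set (R : realType) (n : nat) (a : R) (U : set 'cV[R]_n) :
  set 'cV[R]_n := [set a *: u | u in U].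

Definition mx_set (R : realType) (p q : nat) (D : 'M[R]_(p, q))
  (U : set 'cV[R]_q) : set 'cV[R]_p := [set D *m u | u in U].

Definition msum (R : realType) (n : nat) (U V : set 'cV[R]_n) : set 'cV[R]_n :=
  [set u + v | u in U & v in V].

Fixpoint state (R : realType) (n m : nat) (A : 'M[R]_n) (B : 'M[R]_(n, m))
    (u : nat -> 'cV[R]_m) (x0 : 'cV[R]_n) (k : nat) : 'cV[R]_n :=
  if k is j.+1 then A *m state A B u x0 j + B *m u j else x0.

(* Controllability of the discrete-time system x_{k+1} = A x_k + B u_k: any
   state can be steered to any other (not merely to the origin, which is a
   weaker requirement when A is singular). *)
Definition controllable (R : realType) (n m : nat) (A : 'M[R]_n)
    (B : 'M[R]_(n, m)) : Prop :=
  forall x0 x1 : 'cV[R]_n, exists (k : nat) (u : nat -> 'cV[R]_m),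
    state A B u x0 k = x1.

Definition strictly_stable (R : realType) (n : nat) (A : 'M[R]_n) : Prop :=
  forall l : R[i], eigenvalue (map_mx (real_complex R) A) l -> `|l| < 1.

Fixpoint reach (R : realType) (n m : nat) (A : 'M[R]_n) (E : 'M[R]_(n, m))
    (D : set 'cV[R]_m) (k : nat) : set 'cV[R]_n :=
  if k is j.+1 then msum (mx_set A (reach A E D j)) (mx_set E D)
  else [set 0].

Definition reach_infty (R : realType) (n m : nat) (A : 'M[R]_n)
    (E : 'M[R]_(n, m)) (D : set 'cV[R]_m) : set 'cV[R]_n :=
  \bigcup_k reach A E D k.

Definition scalings (R : realType) (n : nat) (U X : set 'cV[R]_n) : set R :=
  [set a | 0 < a /\ scale_set a U `<=` X].

(* Supremum in the extended reals: the real-valued [sup] would default to 0 on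
   empty or unbounded sets. *)
Definition alpha_star (R : realType) (n m : nat) (A : 'M[R]_n)
    (E : 'M[R]_(n, m)) (X : set 'cV[R]_n) (D : set 'cV[R]_m) : \bar R :=
  ereal_sup (EFin @` scalings (reach_infty A E D) X).

Definition Gamma (R : realType) (r m : nat) (A11 : 'M[R]_r) (E1 : 'M[R]_(r, m))
    (M : nat) : 'M[R]_(r, \sum_(k < M) m) :=
  \mxrow_(k < M) (A11 ^+ k *m E1).

Definition Wset (R : realType) (r m : nat) (A11 : 'M[R]_r)
    (E1 : 'M[R]_(r, m)) (D : set 'cV[R]_m) (M : nat) : set 'cV[R]_r :=
  \big[@msum R r/[set 0]]_(k < M) mx_set (A11 ^+ k *m E1) D.

(* "Full rank" of the r x (M m) matrix Gamma means full row rank r. The real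
   numbers alo and ahi are the returned lower and upper bounds. *)
Definition alg_output (R : realType) (r n m : nat) (A11 : 'M[R]_r)
    (E1 : 'M[R]_(r, m)) (A : 'M[R]_n) (E : 'M[R]_(n, m))
    (X : set 'cV[R]_n) (D : set 'cV[R]_m)
    (eps alo ahi : R) : Prop :=
  let eta := eps * (1 + eps)^-1 in
  exists M N : nat,
  [/\ is_min_nat
        [set i | (1 <= i <= r)%N /\ \rank (Gamma A11 E1 i) = r] M,
      is_min_nat
        [set j | (0 < j)%N /\
           mx_set (A11 ^+ (M * j)) (Wset A11 E1 D M)
             `<=` scale_set eta (Wset A11 E1 D M)] N,
      is_max (scalings (reach A E D (M * N)) X) ahi &
      alo = ahi * (1 + eps)^-1].

(* Main.v *)
(** Write [S_k] for the reachable sets of [(A11, E1)]; those of [(A, E)] are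
    [S_k x {0}]. Since [S_(a+b) = S_a + A11^a S_b] and [Wset = S_M], the choice
    of [N] propagates to [A11^K S_K <= eta S_K] for [K = M N]. With
    [eta = eps / (1 + eps)], convexity gives
    [S_K + A11^K (1 + eps) S_K <= S_K + eps S_K = (1 + eps) S_K], so by
    induction the union of all [S_k] lies in [(1 + eps) S_K], which is the lower
    bound. The algorithm terminates because controllability and Cayley-Hamilton
    give [Gamma] full rank, hence [Wset] contains a ball around 0, while
    [A11^k] decays geometrically. *)
Require Import Defs.
From mathcomp Require Import all_boot all_order all_algebra.
From mathcomp Require Import all_classical all_reals all_analysis.
From mathcomp Require Import complex.

Set Implicit Arguments.
Unset Strict Implicit.
Unset Printing Implicit Defensive.

Import Order.TTheory GRing.Theory Num.Theory.
Import numFieldNormedType.Exports.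

Local Open Scope classical_set_scope.
Local Open Scope ring_scope.

(* mathcomp-analysis shadows [msum] by the sum of measures. *)
Local Notation msum := Defs.msum.

(** * Geometric decay of the powers of a stable matrix *)

(* If [W = (A - z) V], the entries of [A^k V] satisfy
   [x_(k+1) = z x_k + (A^k W)_ij] with [|z| < rho]. *)
Lemma annihilated_pow_bound (C : numFieldType) (n : nat) (A : 'M[C]_n.+1)
    (rho : C) (s : seq C) :
  0 < rho -> {in s, forall z, `|z| < rho} ->
  forall V : 'M[C]_n.+1, horner_mx A (\prod_(z <- s) ('X - z%:P)) * V = 0 ->
  forall i j, exists2 c, 0 <= c & forall k, `|(A ^+ k * V) i j| <= c * rho ^+ k.
Proof.
move=> rho0; elim: s => [|z s IH] sP V.
  rewrite big_nil rmorph1 mul1r => -> i j; exists 0 => // k.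
  by rewrite mulr0 mxE normr0 mul0r.
rewrite big_cons mulrC rmorphM -mulrA => annV i j.
have [t ts|c1 c10 Hc1] := IH _ _ annV i j.
  by apply: sP; rewrite inE ts orbT.
have zrho : 0 < rho - `|z| by rewrite subr_gt0 sP ?mem_head.
have stepE k : (A ^+ k.+1 * V) i j = z * (A ^+ k * V) i j +
    (A ^+ k * (horner_mx A ('X - z%:P) * V)) i j.
  rewrite rmorphB /= horner_mx_X horner_mx_C mulrBl mulrBr mulrA -exprSr
    [z%:M * V]mul_scalar_mx.
  rewrite -scalerAr [X in _ + X]mxE [X in _ + (_ + X)]mxE.
  rewrite [X in _ + (_ - X)]mxE.
  by rewrite addrCA subrr addr0.
(* This constant [c] satisfies |z| c + c1 <= rho c, which is what carries the bound through the
   recursion [stepE]. *)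
exists (`|V i j| + c1 / (rho - `|z|)).
  by rewrite addr_ge0 ?divr_ge0 // ltW.
elim=> [|k IHk].
  by rewrite expr0 mul1r mulr1 lerDl divr_ge0 // ltW.
rewrite stepE (le_trans (ler_normD _ _)) // normrM.
apply: (le_trans (lerD (ler_wpM2l (normr_ge0 z) IHk) (Hc1 k))).
rewrite exprS mulrA -mulrDl mulrA ler_wpM2r ?exprn_ge0 ?(ltW rho0) //.
have c1E : c1 <= (`|V i j| + c1 / (rho - `|z|)) * (rho - `|z|).
  rewrite mulrDl divfK ?gt_eqF // lerDr mulr_ge0 // ltW //.
by rewrite -lerBrDl [`|z| * _]mulrC -mulrBr.
Qed.

(** Over [R[i]] the characteristic polynomial splits into factors ['X - z] with |z| < 1. By
    Cayley-Hamilton their product annihilates [V = 1], so [annihilated_pow_bound] applies with a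
    rate between the largest |z| and 1. *)
Lemma strictly_stable_pow_le (R : realType) (n : nat) (A : 'M[R]_n.+1) :
  strictly_stable A ->
  exists c rho : R, [/\ 0 <= c, 0 < rho, rho < 1 &
    forall k i j, `|(A ^+ k) i j| <= c * rho ^+ k].
Proof.
move=> Astab; pose B : 'M[R[i]]_n.+1 := map_mx (real_complex R) A.
have [s] := closed_field_poly_normal (char_poly B).
rewrite (monicP (char_poly_monic B)) scale1r => charE.
have sP : {in s, forall z, `|z| < 1}.
  move=> z zs; apply: Astab; rewrite eigenvalue_root_char charE.
  by rewrite root_prod_XsubC.
have [rho [rho0 rho1 rhoP]] : exists rho : R,
    [/\ 0 < rho, rho < 1 & {in s, forall z, `|z| < rho%:C%C}].
  elim: s sP {charE} => [|z s IH] sP.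
    by exists 2^-1; split; rewrite ?invr_gt0 ?invf_lt1 ?ltr1n.
  have [t ts|rho [rho0 rho1 rhoP]] := IH; first by rewrite sP // inE ts orbT.
  have := sP z (mem_head _ _); rewrite normc_def -(rmorph1 (real_complex R)).
  set a := Num.sqrt _; rewrite ltcR => a1.
  exists (Num.max rho ((a + 1) / 2)); rewrite lt_max rho0 gt_max rho1.
  split=> //; first by rewrite midf_lt.
  move=> t; rewrite inE => /predU1P[->|ts]; last first.
    by apply: lt_le_trans (rhoP t ts) _; rewrite lecR le_max lexx.
  by rewrite normc_def ltcR lt_max midf_lt ?orbT.
have {}rho0C : 0 < rho%:C%C :> R[i] by rewrite -(rmorph0 (real_complex R)) ltcR.
have annB : horner_mx B (\prod_(z <- s) ('X - z%:P)) * 1 = 0.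
  by rewrite -charE Cayley_Hamilton mul0r.
have bnd i j : exists c : R, 0 <= c /\
    forall k, `|(A ^+ k) i j| <= c * rho ^+ k.
  have [c c0 cP] := annihilated_pow_bound rho0C rhoP annB i j.
  (* A nonnegative element of [R[i]] is real, so the constant comes from [R]. *)
  have cE : c = (complex.Re c)%:C%C by apply/esym/RRe_real/ger0_real.
  move: c0 cP; rewrite cE; move: (complex.Re c) => {cE}c c0 cP.
  exists c; split=> [|k]; first by rewrite -lecR.
  have := cP k; rewrite mulr1 -rmorphXn mxE.
  rewrite normc_def /= expr0n addr0 sqrtr_sqr -rmorphXn -rmorphM.
  by rewrite lecR.
have {}bnd (ij : 'I_n.+1 * 'I_n.+1) : exists c : R, 0 <= c /\
    forall k, `|(A ^+ k) ij.1 ij.2| <= c * rho ^+ k by exact: bnd.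
have [c cP] := choice bnd.
exists (\sum_ij c ij), rho; split=> //.
  by apply: sumr_ge0 => ij _; have [] := cP ij.
move=> k i j; apply: le_trans (proj2 (cP (i, j)) k) _.
rewrite ler_wpM2r ?exprn_ge0 ?(ltW rho0) //.
rewrite (bigD1 (i, j)) //= lerDl sumr_ge0 // => ij _.
by have [] := cP ij.
Qed.

(** * Controllability and the rank of [Gamma] *)

(** Reducing ['X^k] modulo the characteristic polynomial leaves degree at most n, so by
    Cayley-Hamilton every power of [A] is a combination of the first n + 1. *)
Lemma horner_mx_ctrb0 (R : fieldType) (n m : nat) (A : 'M[R]_n.+1)
    (E : 'M[R]_(n.+1, m)) (y : 'rV[R]_n.+1) :
  (forall k, (k < n.+1)%N -> y *m (A ^+ k *m E) = 0) ->
  forall k, y *m (A ^+ k *m E) = 0.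
Proof.
move=> y0 k.
have pE (p : {poly R}) : (size p <= n.+1)%N -> y *m (horner_mx A p *m E) = 0.
  move=> sp; rewrite -[p]coefK poly_def rmorph_sum /= mulmx_suml mulmx_sumr.
  apply: big1 => i _; rewrite horner_mxZ rmorphXn /= horner_mx_X.
  by rewrite -scalemxAl -scalemxAr y0 ?scaler0 // (leq_trans _ sp).
have -> : A ^+ k = horner_mx A ('X^k %% char_poly A).
  rewrite -[in LHS](horner_mx_X A) -rmorphXn /=.
  rewrite {1}(divp_eq 'X^k (char_poly A)) rmorphD rmorphM /=.
  by rewrite Cayley_Hamilton mulr0 add0r.
apply: pE; rewrite -ltnS -(size_char_poly A) ltn_modp.
by rewrite monic_neq0 ?char_poly_monic.
Qed.

(** A row [y] in the left kernel of [Gamma] kills every A^k E, hence every state reachable from 0.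
    Basis vectors are reachable, so [y] is 0. *)
Lemma controllable_rank_Gamma (R : realType) (r m : nat) (A : 'M[R]_r)
    (E : 'M[R]_(r, m)) :
  (1 <= r)%N -> controllable A E -> \rank (Gamma A E r) = r.
Proof.
case: r A E => // r A E _ ctrl; apply/eqP; rewrite -/(row_free _) -kermx_eq0.
apply/eqP/row_matrixP => l; rewrite row0.
set y := row l _.
have yG : y *m Gamma A E r.+1 = 0 by rewrite -row_mul mulmx_ker row0.
have y0 : forall k, y *m (A ^+ k *m E) = 0.
  apply: horner_mx_ctrb0 => k kr; move: yG; rewrite /Gamma mul_mxrow.
  by move/mxrowP/(_ (Ordinal kr)); rewrite mxrowK submxrow0 /=.
(* The extra power [j] absorbs the factor [A] that each unfolding of [state] produces. *)
have ystate u k j : y *m (A ^+ j *m state A E u 0 k) = 0.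
  elim: k j => [|k IH] j /=; first by rewrite !mulmx0.
  have -> : y *m (A ^+ j *m (A *m state A E u 0 k + E *m u k)) =
      y *m (A ^+ j.+1 *m state A E u 0 k) + y *m (A ^+ j *m E) *m u k.
    by rewrite !mulmxDr exprSr -mulmxE !mulmxA.
  by rewrite IH y0 mul0mx addr0.
apply/trmx_inj/colP => i.
have [k [u xE]] := ctrl 0 (delta_mx i 0).
have := ystate u k 0%N; rewrite expr0 mul1mx xE -colE.
by move/colP/(_ 0); rewrite !mxE.
Qed.

(** * Algebra and convexity of Minkowski sums and linear images *)

Lemma convex_setP (R : realType) (n : nat) (U : set 'cV[R]_n) :
  convex_set U <-> forall x y (t : R), U x -> U y -> 0 <= t -> t <= 1 ->
    U (t *: x + (1 - t) *: y).
Proof.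
split=> [cU x y t Ux Uy t0 t1|cU x y t]; last first.
  by rewrite !inE => Ux Uy; apply: cU.
by have := cU x y (Itv01 t0 t1); rewrite !inE; apply.
Qed.

Lemma msumC (R : realType) (n : nat) (U V : set 'cV[R]_n) :
  msum U V = msum V U.
Proof.
by apply/seteqP; split=> _ [u Uu [v Vv <-]]; exists v => //; exists u => //;
  rewrite addrC.
Qed.

Lemma msumA (R : realType) (n : nat) (U V W : set 'cV[R]_n) :
  msum U (msum V W) = msum (msum U V) W.
Proof.
apply/seteqP; split.
  move=> _ [u Uu [_ [v Vv [w Ww <-]] <-]]; exists (u + v).
    by exists u => //; exists v.
  by exists w; rewrite ?addrA.
move=> _ [_ [u Uu [v Vv <-]] [w Ww <-]]; exists u => //.
by exists (v + w); rewrite ?addrA //; exists v => //; exists w.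
Qed.

Lemma msum0 (R : realType) (n : nat) (U : set 'cV[R]_n) : msum [set 0] U = U.
Proof.
apply/seteqP; split=> [_ [_ -> [u Uu <-]]|u Uu]; first by rewrite add0r.
by exists 0 => //; exists u; rewrite ?add0r.
Qed.

Lemma mx_set_msum (R : realType) (p q : nat) (A : 'M[R]_(p, q))
    (U V : set 'cV[R]_q) :
  mx_set A (msum U V) = msum (mx_set A U) (mx_set A V).
Proof.
apply/seteqP; split.
  move=> _ [_ [u Uu [v Vv <-]] <-]; exists (A *m u); first by exists u.
  by exists (A *m v); rewrite ?mulmxDr //; exists v.
move=> _ [_ [u Uu <-] [_ [v Vv <-] <-]]; exists (u + v); rewrite ?mulmxDr //.
by exists u => //; exists v.
Qed.

Lemma mx_set0 (R : realType) (p q : nat) (A : 'M[R]_(p, q)) :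
  mx_set A [set 0] = [set 0].
Proof. by rewrite /mx_set image_set1 mulmx0. Qed.

Lemma mx_set1 (R : realType) (n : nat) (U : set 'cV[R]_n) : mx_set 1%:M U = U.
Proof.
by rewrite /mx_set -[RHS]image_id; apply: eq_imagel => u _; rewrite mul1mx.
Qed.

Lemma mx_set_comp (R : realType) (p q l : nat) (A : 'M[R]_(p, q))
    (B : 'M[R]_(q, l)) (U : set 'cV[R]_l) :
  mx_set A (mx_set B U) = mx_set (A *m B) U.
Proof.
by rewrite /mx_set image_comp; apply: eq_imagel => u _; rewrite /= mulmxA.
Qed.

Lemma convex_msum (R : realType) (n : nat) (U V : set 'cV[R]_n) :
  convex_set U -> convex_set V -> convex_set (msum U V : set 'cV[R]_n).
Proof.
move=> /convex_setP cU /convex_setP cV; apply/convex_setP.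
move=> _ _ t [u Uu [v Vv <-]] [u' Uu' [v' Vv' <-]] t0 t1.
exists (t *: u + (1 - t) *: u'); first exact: cU.
exists (t *: v + (1 - t) *: v'); first exact: cV.
by rewrite !scalerDr addrACA.
Qed.

Lemma convex_mx_set (R : realType) (p q : nat) (A : 'M[R]_(p, q))
    (U : set 'cV[R]_q) :
  convex_set U -> convex_set (mx_set A U : set 'cV[R]_p).
Proof.
move=> /convex_setP cU; apply/convex_setP.
move=> _ _ t [u Uu <-] [u' Uu' <-] t0 t1.
exists (t *: u + (1 - t) *: u'); first exact: cU.
by rewrite mulmxDr -!scalemxAr.
Qed.

(** * Reachable sets: splitting, monotonicity and contraction *)

Section Reach.
Variables (R : realType) (n m : nat) (A : 'M[R]_n) (E : 'M[R]_(n, m)).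
Variable D : set 'cV[R]_m.

(** By linearity, the state after the first b steps is carried on by [A ^+ a], and the last a inputs
    add a state reached from 0. *)
Lemma reachD (a b : nat) :
  reach A E D (a + b) =
  msum (reach A E D a) (mx_set (A ^+ a) (reach A E D b)).
Proof.
elim: a => [|a IH] /=; first by rewrite expr0 mx_set1 msum0.
rewrite IH mx_set_msum mx_set_comp mulmxE -exprS -!msumA.
by congr msum; rewrite msumC.
Qed.

Lemma convex_reach (k : nat) : convex_set D -> convex_set (reach A E D k).
Proof.
move=> cD; elim: k => [|k IH] /=; last first.
  by apply: convex_msum; apply: convex_mx_set.
apply/convex_setP => _ _ t -> -> _ _ /=.
by rewrite !scaler0 addr0.
Qed.

Lemma reach0 (k : nat) : D 0 -> reach A E D k 0.
Proof.
move=> D0; elim: k => //= k IH; exists 0; first by exists 0; rewrite ?mulmx0.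
by exists 0; rewrite ?addr0 //; exists 0; rewrite ?mulmx0.
Qed.

(** Zero input keeps the state at 0 for the first k - j steps. *)
Lemma reach_le (j k : nat) : D 0 -> (j <= k)%N ->
  reach A E D j `<=` reach A E D k.
Proof.
move=> D0 /subnKC <- u Uu; rewrite reachD; exists u => //.
exists 0; last by rewrite addr0.
by exists 0; rewrite ?mulmx0 //; apply: reach0.
Qed.

(** Makes [reachD] available for the set built in step (i). *)
Lemma Wset_reach (M : nat) : Wset A E D M = reach A E D M.
Proof.
elim: M => [|M IH]; first by rewrite /Wset big_ord0.
rewrite /Wset big_ord_recl expr0 mul1mx /= -IH /Wset msumC.
rewrite (big_morph _ (@mx_set_msum _ _ _ A) (mx_set0 A)).
congr msum; apply: eq_bigr => i _.
by rewrite mx_set_comp mulmxA mulmxE -exprS.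
Qed.

(** [reach A E D (M * j)] is the sum of the images of [reach A E D M] under A^(M i), i < j. These
    powers commute with [A ^+ K], so each summand contracts by the same [eta]. *)
Lemma contraction_reach_mul (M K : nat) (eta : R) :
  mx_set (A ^+ K) (reach A E D M) `<=` scale_set eta (reach A E D M) ->
  forall j, mx_set (A ^+ K) (reach A E D (M * j)) `<=`
            scale_set eta (reach A E D (M * j)).
Proof.
move=> contr; elim=> [|j IH].
  rewrite muln0 mx_set0 => _ ->; exists 0 => //; exact: scaler0.
rewrite mulnS reachD mx_set_msum mx_set_comp mulmxE -exprD addnC exprD -mulmxE.
rewrite -mx_set_comp => _ [x xW [_ [z zW <-] <-]].
have [x' x'W <-] := contr _ xW; have [z' z'W <-] := IH _ zW.
exists (x' + A ^+ M *m z'); last by rewrite scalerDr -scalemxAr.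
by exists x' => //; exists (A ^+ M *m z') => //; exists z'.
Qed.

(* S + (1 + eps) eta S = S + eps S = (1 + eps) S by convexity of S. *)
Lemma reach_sub_scale (K : nat) (eps : R) :
  D 0 -> convex_set D -> 0 < eps ->
  mx_set (A ^+ K) (reach A E D K) `<=`
    scale_set (eps * (1 + eps)^-1) (reach A E D K) ->
  forall q, reach A E D (K * q) `<=` scale_set (1 + eps) (reach A E D K).
Proof.
move=> D0 cD e0 contr; have e1 : 1 + eps != 0 by rewrite gt_eqF // addr_gt0.
elim=> [|q IH].
  by rewrite muln0 => _ ->; exists 0; [exact: reach0|exact: scaler0].
rewrite mulnS reachD => _ [x xS [_ [z zS <-] <-]].
have [z' z'S <-] := IH _ zS.
have [|y yS yE] := contr (A ^+ K *m z'); first by exists z'.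
(* The point is x + (1 + eps) eta y = x + eps y; dividing by 1 + eps gives weights 1 / (1 + eps) and
   eps / (1 + eps), which sum to 1. *)
exists ((1 + eps)^-1 *: x + (1 - (1 + eps)^-1) *: y).
  move/convex_setP: (@convex_reach K cD); apply=> //.
    by rewrite invr_ge0 ltW // addr_gt0.
  by rewrite invf_le1 ?addr_gt0 // lerDl ltW.
rewrite -scalemxAr -yE scalerDr !scalerA mulfV // scale1r mulrBr mulr1 mulfV //.
by congr (_ + _ *: _); rewrite addrAC subrr add0r mulrCA mulfV ?mulr1.
Qed.

End Reach.

(** The lower block starts at 0 and is driven neither by the input nor by the upper block, so it
    stays 0. *)
Lemma reach_col_mx (R : realType) (r s m : nat) (A11 : 'M[R]_r)
    (A12 : 'M[R]_(r, s)) (A22 : 'M[R]_s) (E1 : 'M[R]_(r, m))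
    (D : set 'cV[R]_m) (k : nat) :
  reach (block_mx A11 A12 0 A22) (col_mx E1 0) D k =
  [set col_mx x 0 | x in reach A11 E1 D k].
Proof.
elim: k => [|k IH] /=; first by rewrite image_set1 col_mx0.
rewrite IH; apply/seteqP; split.
  move=> _ [_ [_ [x Sx <-] <-] [_ [d Dd <-] <-]].
  exists (A11 *m x + E1 *m d).
    by exists (A11 *m x); [exists x|exists (E1 *m d) => //; exists d].
  rewrite mul_block_col mul_col_mx !mulmx0 !mul0mx !addr0.
  by rewrite add_col_mx addr0.
move=> _ [_ [_ [x Sx <-] [_ [d Dd <-] <-]] <-].
exists (block_mx A11 A12 0 A22 *m col_mx x 0).
  by exists (col_mx x 0) => //; exists x.
exists (col_mx E1 0 *m d); first by exists d.
rewrite mul_block_col mul_col_mx !mulmx0 !mul0mx !addr0.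
by rewrite add_col_mx addr0.
Qed.

(** * Existence of minima, norm bounds and the largest scaling *)

Lemma ex_is_min_nat (S : set nat) : S !=set0 -> exists i, is_min_nat S i.
Proof.
move=> [i Si]; have exS : exists i, `[< S i >] by exists i; apply/asboolP.
case: (ex_minnP exS) => j /asboolP Sj jP; exists j; split=> // k Sk.
by apply: jP; apply/asboolP.
Qed.

Lemma mx_norm_le (R : realType) (p q : nat) (A : 'M[R]_(p, q)) (c : R) :
  0 <= c -> (forall i j, `|A i j| <= c) -> `|A| <= c.
Proof.
by move=> c0 Ac; rewrite /Num.norm /= mx_normrE; apply: bigmax_le.
Qed.

Lemma entry_le_mx_norm (R : realType) (p q : nat) (A : 'M[R]_(p, q)) i j :
  `|A i j| <= `|A|.
Proof.
rewrite [leRHS]/Num.norm /= mx_normrE.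
by apply: (@le_bigmax _ R _ 0 (fun ij => `|A ij.1 ij.2|) (i, j)).
Qed.

(** The norm is the largest absolute entry; an entry of the product sums q terms, whence the factor
    [q%:R]. *)
Lemma mulmx_norm_le (R : realType) (p q l : nat) (A : 'M[R]_(p, q))
    (B : 'M[R]_(q, l)) :
  `|A *m B| <= q%:R * `|A| * `|B|.
Proof.
apply: mx_norm_le => [|i j]; first by rewrite !mulr_ge0.
rewrite mxE (le_trans (ler_norm_sum _ _ _)) //.
have -> : q%:R * `|A| * `|B| = \sum_(k < q) `|A| * `|B|.
  by rewrite sumr_const card_ord -mulrA mulr_natl.
apply: ler_sum => k _.
by rewrite normrM ler_pM // entry_le_mx_norm.
Qed.

Lemma compact_norm_le (R : realType) (n : nat) (U : set 'cV[R]_n) :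
  compact U -> exists B, forall u, U u -> `|u| <= B.
Proof.
move=> /compact_bounded [B [_ UB]]; exists (B + 1) => u Uu.
by apply: UB => //; rewrite ltrDl.
Qed.

Lemma interior0_ball (R : realType) (n : nat) (U : set 'cV[R]_n) :
  interior U 0 -> exists2 e : R, 0 < e & forall u, `|u| < e -> U u.
Proof.
move=> /nbhs_normP [e /= e0 eU]; exists e => // u ue; apply: eU => /=.
by rewrite sub0r normrN.
Qed.

(** The ball inside [X] and the bound on [U] give one admissible scaling; the bound on [X] and a
    nonzero point of [U] bound them all; closedness of [X] makes the supremum admissible. *)
Lemma max_scaling (R : realType) (n : nat) (U X : set 'cV[R]_n) (B : R) :
  compact X -> interior X 0 -> (forall u, U u -> `|u| <= B) ->
  (exists2 u, U u & u != 0) -> exists a, is_max (scalings U X) a.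
Proof.
move=> cX iX UB [u Uu u0]; have nu0 : 0 < `|u| by rewrite normr_gt0.
have B0 : 0 < B by rewrite (lt_le_trans nu0) ?UB.
have [C XC] := compact_norm_le cX; have [e e0 eX] := interior0_ball iX.
have S0 : scalings U X (e / 2 / B).
  split; first by rewrite !divr_gt0.
  move=> _ [v Uv <-]; apply: eX.
  rewrite normrZ gtr0_norm ?divr_gt0 // mulrAC ltr_pdivrMr //.
  rewrite (le_lt_trans (ler_wpM2l _ (UB _ Uv))) ?divr_ge0 ?ltW //.
  by rewrite ltr_pM2r // ltr_pdivrMr // ltr_pMr // ltr1n.
have Sub : has_ubound (scalings U X).
  exists (C / `|u|) => a [a0 aX]; rewrite ler_pdivlMr //.
  by rewrite -(gtr0_norm a0) -normrZ; apply: XC; apply: aX; exists u.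
have sS : has_sup (scalings U X) by split=> //; exists (e / 2 / B).
exists (sup (scalings U X)); split; last exact: ub_le_sup.
split.
  by apply: lt_le_trans (ub_le_sup Sub S0); rewrite !divr_gt0.
move=> _ [v Uv <-].
(* For fixed [v] this closed set contains all admissible scalings, hence their supremum. *)
have clX : closed ((fun a : R => a *: v) @^-1` X).
  apply: closed_comp; last exact: compact_closed (@norm_hausdorff _ _) cX.
  by move=> a _; exact: scalel_continuous.
apply: clX; have := closure_sup (proj1 sS) Sub; apply: closureS.
by move=> a [_ aX]; apply: aX; exists v.
Qed.

Lemma msum_norm_le (R : realType) (n : nat) (U V : set 'cV[R]_n) (B C : R) :
  (forall u, U u -> `|u| <= B) -> (forall v, V v -> `|v| <= C) ->
  forall w, msum U V w -> `|w| <= B + C.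
Proof.
move=> UB VC _ [u Uu [v Vv <-]].
by rewrite (le_trans (ler_normD _ _)) // lerD ?UB ?VC.
Qed.

Lemma mx_set_norm_le (R : realType) (p q : nat) (A : 'M[R]_(p, q))
    (U : set 'cV[R]_q) (B : R) :
  (forall u, U u -> `|u| <= B) ->
  forall w, mx_set A U w -> `|w| <= q%:R * `|A| * B.
Proof.
move=> UB _ [u Uu <-]; rewrite (le_trans (mulmx_norm_le _ _)) //.
by rewrite ler_wpM2l ?mulr_ge0 ?UB.
Qed.

Lemma reach_norm_le (R : realType) (n m : nat) (A : 'M[R]_n)
    (E : 'M[R]_(n, m)) (D : set 'cV[R]_m) (k : nat) :
  compact D -> exists B, forall u, reach A E D k u -> `|u| <= B.
Proof.
move=> /compact_norm_le [C DC]; elim: k => [|k [B IH]] /=.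
  by exists 0 => _ ->; rewrite normr0.
by eexists; apply: msum_norm_le; apply: mx_set_norm_le; eassumption.
Qed.

(** Stay at 0, then apply at the last step a small multiple of a basis vector that [E] does not
    kill. *)
Lemma reachS_neq0 (R : realType) (n m : nat) (A : 'M[R]_n)
    (E : 'M[R]_(n, m)) (D : set 'cV[R]_m) (k : nat) :
  interior D 0 -> E != 0 -> exists2 u, reach A E D k.+1 u & u != 0.
Proof.
move=> iD E0; have [e e0 eD] := interior0_ball iD.
have [j Ej] : exists j, col j E != 0.
  apply/not_existsP => Ecol; move/eqP: E0; apply.
  apply/trmx_inj/row_matrixP => j; rewrite -tr_col trmx0 row0.
  by have /negP/negPn/eqP -> := Ecol j; rewrite trmx0.
have e20 : 0 < e / 2 by rewrite divr_gt0.
exists (E *m ((e / 2) *: delta_mx j 0)); last first.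
  by rewrite -scalemxAr -colE scaler_eq0 negb_or Ej gt_eqF.
exists 0; first by exists 0; [apply: reach0; exact: nbhs_singleton|rewrite mulmx0].
exists (E *m ((e / 2) *: delta_mx j 0)); rewrite ?add0r //.
exists ((e / 2) *: delta_mx j 0) => //; apply: eD.
rewrite normrZ gtr0_norm //; apply: (@le_lt_trans _ _ (e / 2 * 1)).
  rewrite ler_wpM2l ?(ltW e20) //; apply: mx_norm_le => // a b.
  by rewrite mxE; case: (_ && _); rewrite ?normr1 ?normr0.
by rewrite mulr1 ltr_pdivrMr // ltr_pMr // ltr1n.
Qed.

(** * Contraction of [Wset] by high powers of [A] *)

(** Full row rank gives a right inverse [B] of [Gamma]. The blocks of [B *m w] are inputs producing
    [w], and they lie in [D] once [w] is small. *)
Lemma Wset_ball (R : realType) (r m : nat) (A : 'M[R]_r) (E : 'M[R]_(r, m))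
    (D : set 'cV[R]_m) (M : nat) :
  interior D 0 -> \rank (Gamma A E M) = r ->
  exists2 e : R, 0 < e & forall w, `|w| < e -> Wset A E D M w.
Proof.
move=> /interior0_ball [e e0 eD] rG.
have /row_freeP [B GB] : row_free (Gamma A E M) by apply/eqP.
set K := r%:R * `|B| + 1; have K0 : 0 < K by rewrite ltr_wpDl ?mulr_ge0.
exists (e / K) => [|w we]; first by rewrite divr_gt0.
have -> : w = \sum_(k < M) (A ^+ k *m E) *m submxcol (B *m w) k.
  by rewrite -mul_mxrow_mxcol submxcolK mulmxA GB mul1mx.
rewrite /Wset; apply: (big_ind2 (fun (U : set 'cV_r) x => U x)) => //.
  by move=> U x V y Ux Vy; exists x => //; exists y.
move=> k _; exists (submxcol (B *m w) k) => //; apply: eD.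
apply: (@le_lt_trans _ _ `|B *m w|).
  by apply: mx_norm_le => // i j; rewrite mxE entry_le_mx_norm.
rewrite (le_lt_trans (mulmx_norm_le _ _)) //.
move: we; rewrite ltr_pdivlMr // mulrC; apply: le_lt_trans.
by rewrite ler_wpM2r // lerDl.
Qed.

(** [Wset] is bounded and the powers of [A] tend to 0, so eta^-1 A^(M N) maps [Wset] into the ball
    that it contains. *)
Lemma ex_contraction (R : realType) (r m : nat) (A : 'M[R]_r)
    (E : 'M[R]_(r, m)) (D : set 'cV[R]_m) (M : nat) (eta : R) :
  strictly_stable A -> compact D -> interior D 0 -> 0 < eta -> (0 < M)%N ->
  (0 < r)%N -> \rank (Gamma A E M) = r ->
  exists N, (0 < N)%N /\ mx_set (A ^+ (M * N)) (Wset A E D M) `<=`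
    scale_set eta (Wset A E D M).
Proof.
move=> sA cD iD eta0 M0 r0 rG; have [e e0 We] := Wset_ball iD rG.
have [B WB] : exists B, forall w, Wset A E D M w -> `|w| <= B.
  by rewrite Wset_reach; exact: reach_norm_le.
have B0 : 0 <= B.
  by apply: le_trans (WB 0 _) => //; apply: We; rewrite normr0.
have [c [rho [c0 rho0 rho1 Arho]]] : exists c rho : R, [/\ 0 <= c, 0 < rho,
    rho < 1 & forall k i j, `|(A ^+ k) i j| <= c * rho ^+ k].
  by case: (r) r0 A sA {E rG We WB} => // r' _ A' /strictly_stable_pow_le.
(* |A^k w| <= K rho^k on [Wset]; the added 1 allows division by [K]. *)
set K := r%:R * c * B + 1.
have K0 : 0 < K by rewrite ltr_wpDl ?mulr_ge0.
have /cvgr0_norm_lt/(_ (eta * e / K)) : (fun k => rho ^+ k) @ \oo --> 0.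
  by apply: cvg_expr; rewrite gtr0_norm.
rewrite divr_gt0 ?mulr_gt0 // => /(_ isT) [N _ NP].
(* The successor makes the witness positive, and M (N + 1) >= N because M > 0. *)
exists N.+1; split=> // _ [w Ww <-].
exists (eta^-1 *: (A ^+ (M * N.+1) *m w)); last first.
  by rewrite scalerA mulfV ?scale1r // gt_eqF.
apply: We; rewrite normrZ gtr0_norm ?invr_gt0 // mulrC ltr_pdivrMr // mulrC.
have := NP (M * N.+1)%N; rewrite /= (leq_trans (leqnSn N)) ?leq_pmull //.
move=> /(_ isT); rewrite ger0_norm ?exprn_ge0 ?(ltW rho0) //.
rewrite ltr_pdivlMr //; apply: le_lt_trans.
rewrite (le_trans (mulmx_norm_le _ _)) //.
have AK : `|A ^+ (M * N.+1)| <= c * rho ^+ (M * N.+1).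
  by apply: mx_norm_le => //; rewrite mulr_ge0 ?exprn_ge0 ?(ltW rho0).
apply: (@le_trans _ _ (r%:R * (c * rho ^+ (M * N.+1)) * B)).
  by rewrite ler_pM ?mulr_ge0 ?ler_wpM2l ?WB.
rewrite [rho ^+ _ * K]mulrC mulrA mulrAC ler_wpM2r ?exprn_ge0 ?(ltW rho0) //.
by rewrite lerDl.
Qed.

(** * Termination and correctness of the algorithm *)

Theorem theorem16 (R : realType) (r s m : nat)
    (A : 'M[R]_(r + s)) (E : 'M[R]_(r + s, m))
    (A11 : 'M[R]_r) (A12 : 'M[R]_(r, s)) (A22 : 'M[R]_s) (E1 : 'M[R]_(r, m))
    (X : set 'cV[R]_(r + s)) (D : set 'cV[R]_m) (eps : R)
    (hr : (1 <= r)%N)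
    (hA : A = block_mx A11 A12 0 A22)
    (hE : E = col_mx E1 0)
    (hctrl : controllable A11 E1)
    (hX : Cset X)
    (hD : Cset D)
    (hA11 : strictly_stable A11)
    (hA22 : strictly_stable A22)
    (heps : 0 < eps) :
  (exists alo ahi : R, alg_output A11 E1 A E X D eps alo ahi) /\
  (forall alo ahi : R, alg_output A11 E1 A E X D eps alo ahi ->
     [/\ (alo%:E <= alpha_star A E X D)%E,
         (alpha_star A E X D <= ahi%:E)%E &
         ahi / alo - 1 = eps]).
Proof.
have [cD kD iD] := hD; have [_ kX iX] := hX.
have D0 : D 0 by exact: nbhs_singleton.
have eps1 : 0 < 1 + eps by rewrite addr_gt0.
split.
  have rankr := controllable_rank_Gamma hr hctrl.
  have [M MP] : exists M, is_min_nat
      [set i | (1 <= i <= r)%N /\ \rank (Gamma A11 E1 i) = r] M.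
    by apply: ex_is_min_nat; exists r; rewrite /= hr leqnn.
  have [[/andP[M0 Mr] rM] _] := MP.
  have eta0 : 0 < eps * (1 + eps)^-1 by rewrite divr_gt0.
  have [N NP] := ex_is_min_nat (ex_contraction hA11 kD iD eta0 M0 hr rM).
  have [[N0 _] _] := NP.
  (* Otherwise [Gamma] would vanish and have rank 0 < r. A nonzero reachable point then bounds the
     scalings above. *)
  have E0 : E != 0.
    rewrite hE; apply/eqP => /(congr1 usubmx); rewrite col_mxKu => E10.
    have GM0 : Gamma A11 E1 M = 0.
      apply/eqP; rewrite /Gamma; apply/eqP/mxrowP => k.
      by rewrite mxrowK E10 linear0 mulmx0 submxrow0.
    by move: rM hr; rewrite GM0 mxrank0 => <-.
  have [u uR u0] : exists2 u, reach A E D (M * N) u & u != 0.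
    by rewrite -(@prednK (M * N)) ?muln_gt0 ?M0 //; exact: reachS_neq0.
  have [B RB] := reach_norm_le A E (M * N) kD.
  have [ahi ahiP] := max_scaling kX iX RB (ex_intro2 _ _ u uR u0).
  by exists (ahi * (1 + eps)^-1), ahi, M, N; split.
move=> alo ahi [M [N [[[/andP[M0 _] _] _] [[N0 contr] _] [[ahi0 ahiX] ahi_ub] ->]]].
split.
- apply: ereal_sup_ubound; exists (ahi * (1 + eps)^-1) => //; split.
    by rewrite divr_gt0.
  move=> _ [x [k _ xR] <-].
  move: contr; rewrite Wset_reach => /contraction_reach_mul /(_ N) contr.
  have [z zR zx] : scale_set (1 + eps) (reach A E D (M * N)) x.
    move: xR; rewrite hA hE !reach_col_mx => -[x1 x1R <-].
    (* Since k <= M N k, monotonicity places [x1] in a reachable set whose horizon is a multiple of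
       M N. *)
    have [|z zR <-] := reach_sub_scale D0 cD heps contr (q := k) (t := x1).
      by apply: (reach_le D0 _ x1R); rewrite leq_pmull // muln_gt0 M0.
    exists (col_mx z 0); first by exists z.
    by rewrite scale_col_mx scaler0.
  apply: ahiX; exists z => //.
  by rewrite -zx scalerA -mulrA mulVf ?mulr1 // gt_eqF.
(* A scaling admissible for the whole union is admissible at horizon M N, where [ahi] is maximal. *)
- apply: ge_ereal_sup => _ [a [a0 aX] <-]; rewrite lee_fin.
  apply: ahi_ub; split=> // _ [x xR <-]; apply: aX; exists x => //.
  by exists (M * N)%N.
- by rewrite invfM invrK mulrA mulfV ?gt_eqF // mul1r addrAC subrr add0r.
Qed.
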